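(* Let $G$ be a connected (finite, simple) graph with forest number $\mathrm{f}(G)$. Then $\mathrm{rc}(G) \leq \mathrm{f}(G) + 2$.
   Context: For an edge-coloring of a graph $G$, a path is rainbow if no two of its edges have the same color; $G$ is rainbow-connected if every pair of vertices is joined by a rainbow path. The rainbow connection number $\mathrm{rc}(G)$ is the minimum number of colors in an edge-coloring making $G$ rainbow-connected. The forest number $\mathrm{f}(G)$ is the maximum number of vertices of an induced subgraph of $G$ that is a forest. *)

(* Defs.v *)
From mathcomp Require Import all_boot.
Set Implicit Arguments. Unset Strict Implicit. Unset Printing Implicit Defensive.

Definition simple_graph (T : finType) (e : rel T) : Prop :=
  symmetric e /\ irreflexive e.

Definition connected_graph (T : finType) (e : rel T) : Prop :=
  forall x y : T, connect e x y.

(* An edge is the unordered pair {x, y} with e x y; an edge-colouring with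
   k colours assigns a colour in 'I_k to each unordered pair of vertices
   (values on non-edges are irrelevant). *)
Definition edge_coloring (T : finType) (k : nat) := {ffun {set T} -> 'I_k}.

Definition path_colors (T : finType) k (c : edge_coloring T k) (x : T) (p : seq T)
  : seq 'I_k :=
  pairmap (fun u v => c [set u; v]) x p.

Definition rainbow_path (T : finType) (e : rel T) k (c : edge_coloring T k)
  (x y : T) (p : seq T) : bool :=
  [&& path e x p, last x p == y, uniq (x :: p) & uniq (path_colors c x p)].

Definition rainbow_connected (T : finType) (e : rel T) k (c : edge_coloring T k)
  : Prop :=
  forall x y : T, exists p : seq T, rainbow_path e c x y p.

Definition rc_le (T : finType) (e : rel T) (k : nat) : Prop :=
  exists c : edge_coloring T k, rainbow_connected e c.


Definition has_cycle_in (T : finType) (e : rel T) (F : {set T}) : Prop :=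
  exists (x : T) (p : seq T),
    [/\ 2 <= size p, uniq (x :: p), all (fun v => v \in F) (x :: p),
        path e x p & e (last x p) x].

Definition induced_forest (T : finType) (e : rel T) (F : {set T}) : Prop :=
  ~ has_cycle_in e F.

Definition forest_number (T : finType) (e : rel T) (m : nat) : Prop :=
  (exists F : {set T}, induced_forest e F /\ #|F| = m) /\
  (forall F : {set T}, induced_forest e F -> #|F| <= m).

(* rc(G) <= k : the least number of colours is at most k, i.e. some
   rainbow-connecting colouring uses at most k colours *)
Definition rc_at_most (T : finType) (e : rel T) (k : nat) : Prop :=
  exists2 j, j <= k & rc_le e j.

(* Main.v *)
Require Import Defs.
From mathcomp Require Import all_boot.
Set Implicit Arguments. Unset Strict Implicit. Unset Printing Implicit Defensive.

(** Every connected graph on at least two vertices has, through any prescribed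
    vertex, a connected dominating set D smaller than some induced forest.
    A spanning tree of D is rainbow with fewer than #|D| colors, and when all
    degrees are at least 2 three more colors reach the vertices outside D.
    A vertex of degree 1 can be deleted at the price of one color, and it
    enlarges any induced forest of the rest. *)

Section Graph.
Variables (T : finType) (e : rel T).
Hypotheses (e_sym : symmetric e) (eirr : irreflexive e).

(** * Connectivity inside a vertex set *)

(** Kept as a relation on all of [T], with the vertices outside [S] isolated, so that nested sets
    are compared without changing types. *)
Definition induced (S : {set T}) : rel T :=
  fun u v => [&& e u v, u \in S & v \in S].
Arguments induced S u v /.

Definition connected_in (S : {set T}) : Prop :=
  {in S &, forall u v, connect (induced S) u v}.

Lemma induced_sym S : symmetric (induced S).
Proof. by move=> u v; rewrite /induced /= e_sym [(u \in S) && _]andbC. Qed.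

Lemma induced_connectC S u v :
  connect (induced S) u v = connect (induced S) v u.
Proof. exact/sym_connect_sym/induced_sym. Qed.

Lemma connect_induced_sub (A B : {set T}) u v :
  A \subset B -> connect (induced A) u v -> connect (induced B) u v.
Proof.
move=> sAB; apply: connect_sub => a b /and3P[eab aA bA].
by apply: connect1; rewrite /= eab !(subsetP sAB).
Qed.

Lemma connected_in_root (S : {set T}) r :
  {in S, forall u, connect (induced S) r u} -> connected_in S.
Proof.
move=> Sr u v uS vS; apply: connect_trans (Sr _ vS).
by rewrite induced_connectC Sr.
Qed.

Lemma connect_map (r1 r2 : rel T) (f : T -> T) :
  (forall u v, r1 u v -> connect r2 (f u) (f v)) ->
  forall u v, connect r1 u v -> connect r2 (f u) (f v).
Proof.
move=> fr u v /connectP[p + ->] {v}; elim: p u => [|w p IHp] u //=.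
case/andP=> /fr ruw /IHp; exact: connect_trans.
Qed.

(* Collapsing S :\: A onto x is a retraction of S onto A. *)
Lemma connected_in_retract (S A : {set T}) x :
  connected_in S -> A \subset S -> x \in A ->
  (forall u v, u \in A -> v \in S -> v \notin A -> e u v -> u = x) ->
  connected_in A.
Proof.
move=> cS /subsetP sAS xA out u v uA vA.
pose f u := if u \in A then u else x.
have -> : u = f u by rewrite /f uA.
have -> : v = f v by rewrite /f vA.
apply: connect_map (cS _ _ (sAS _ uA) (sAS _ vA)) => a b /and3P[eab aS bS].
rewrite /f; case: ifPn => aA; case: ifPn => bA.
- by apply: connect1; rewrite /= eab aA bA.
- by rewrite (out a b).
- by rewrite (out b a) // e_sym.
- exact: connect0.
Qed.

(** Otherwise [X] would be closed under adjacency in [S], and a walk from [r] could never reach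
    [b]. *)
Lemma connected_in_crossing (S X : {set T}) r b :
  connected_in S -> r \in X -> X \subset S -> b \in S -> b \notin X ->
  exists u v, [/\ u \in X, v \in S, v \notin X & e u v].
Proof.
move=> cS rX /subsetP sXS bS bX.
have [/existsP[u /existsP[v /and4P[*]]]|noX] := boolP [exists u, exists v,
  [&& u \in X, v \in S, v \notin X & e u v]]; first by exists u, v.
have noXP u v : u \in X -> v \in S -> e u v -> v \in X.
  move=> uX vS euv; apply: contraR noX => vX.
  by apply/existsP; exists u; apply/existsP; exists v; rewrite uX vS vX.
suff /closed_connect/(_ _ _ (cS _ _ (sXS _ rX) bS)) : closed (induced S) (mem X).
  by rewrite /= rX (negPf bX).
move=> u v /and3P[euv uS vS]; apply/idP/idP => [uX|vX]; first exact: noXP euv.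
by rewrite e_sym in euv; apply: noXP euv.
Qed.

Lemma connected_in_neighbor (S : {set T}) q b :
  connected_in S -> q \in S -> b \in S -> b != q ->
  exists2 x, x \in S :\ q & e q x.
Proof.
move=> cS qS bS bq.
have [||||u [v [/set1P-> vS vq qv]]] := @connected_in_crossing S [set q] q b cS.
- exact: set11.
- by rewrite sub1set.
- by [].
- by rewrite inE.
by exists v; rewrite // !inE vS andbT; move: vq; rewrite inE.
Qed.

Lemma connected_in1 x : connected_in [set x].
Proof. by move=> u v /set1P-> /set1P->. Qed.

(** Both alternatives occur when dominating sets are merged at a cut vertex: the first set may
    contain that vertex or only a neighbor of it. *)
Lemma connected_inU (A B : {set T}) a b :
  connected_in A -> connected_in B -> a \in A -> b \in B ->
  a = b \/ e a b -> connected_in (A :|: B).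
Proof.
move=> cA cB aA bB ab; apply: (@connected_in_root _ a) => u /setUP[uA|uB].
  exact/(connect_induced_sub (subsetUl A B))/cA.
apply: (@connect_trans _ _ b); last first.
  exact/(connect_induced_sub (subsetUr A B))/cB.
case: ab => [->|eab]; first exact: connect0.
by apply: connect1; rewrite /= eab !inE aA bB orbT.
Qed.

(** * Cycles and induced forests *)

(** A cyclic sequence has no distinguished start, so it can be rotated to begin at any of its
    vertices. *)
Lemma has_cycle_inP (F : {set T}) :
  has_cycle_in e F <->
  exists s : seq T, [/\ 2 < size s, uniq s, {subset s <= F} & cycle e s].
Proof.
split=> [[x [p [p2 Ux Fx ep el]]]|[[|x p] [//] p2 Ux Fx /=]].
  exists (x :: p); split=> //; first exact/allP.
  by rewrite /= rcons_path ep.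
rewrite rcons_path => /andP[ep el].
by exists x, p; split=> //; apply/allP.
Qed.

Lemma cycle_through (F : {set T}) (s : seq T) x :
  [/\ 2 < size s, uniq s, {subset s <= F} & cycle e s] -> x \in s ->
  exists p : seq T, [/\ 1 < size p, uniq (x :: p), {subset x :: p <= F},
                path e x p & e (last x p) x].
Proof.
move=> [s2 Us Fs es] /rot_to[i p sE]; exists p; rewrite -sE rot_uniq.
split=> //; first by move: s2; rewrite -(size_rot i) sE.
  by move=> y; rewrite mem_rot; apply: Fs.
all: by move: es; rewrite -(rot_cycle i) sE /= rcons_path => /andP[].
Qed.

Lemma induced_forest_small (F : {set T}) : #|F| <= 2 -> induced_forest e F.
Proof.
move=> F2 /has_cycle_inP[s [s2 Us Fs _]].
have /(uniq_leq_size Us) : {subset s <= enum F} by move=> y /Fs; rewrite mem_enum.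
by rewrite -cardE leqNgt (leq_ltn_trans F2).
Qed.

Lemma induced_forest_sub (A B : {set T}) :
  A \subset B -> induced_forest e B -> induced_forest e A.
Proof.
move=> /subsetP sAB fB /has_cycle_inP[s [s2 Us As es]].
by apply/fB/has_cycle_inP; exists s; split=> // y /As/sAB.
Qed.

(** A new cycle would pass through [l], and its two neighbors on that cycle would be distinct
    neighbors of [l] in [S]. *)
Lemma induced_forest_pendant (F S : {set T}) l :
  F \subset S -> (forall u v, u \in S -> v \in S -> e l u -> e l v -> u = v) ->
  induced_forest e F -> induced_forest e (l |: F).
Proof.
move=> /subsetP sFS l1 fF /has_cycle_inP[s cs].
have [ls|ls] := boolP (l \in s); last first.
  case: cs => s2 Us Fs es; apply/fF/has_cycle_inP; exists s; split=> // y ys.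
  by move: (Fs y ys) (ys); rewrite !inE => /predU1P[->|//]; rewrite (negPf ls).
have [[|a [|b p]] [//= _ Up Fp /andP[ela _] ebl]] := cycle_through cs ls.
have inS y : y \in a :: b :: p -> y \in S.
  move=> yp; have := Fp y; rewrite inE yp orbT => /(_ isT)/setU1P[yl|/sFS//].
  by move: Up; rewrite -yl yp.
have la : last b p = a.
  apply: l1 => //; rewrite ?inS ?mem_head //; first by rewrite inE mem_last orbT.
  by rewrite e_sym.
by move: Up; rewrite -la mem_last !andbF.
Qed.

Lemma path_one_side (A B : {set T}) u p :
  (forall a b, a \in A -> b \in B -> ~~ e a b) ->
  path e u p -> {subset u :: p <= A :|: B} -> u \in A -> {subset u :: p <= A}.
Proof.
move=> noAB; elim: p u => [|v p IHp] u /=; first by move=> _ _ uA y /[1!inE]/eqP->.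
case/andP=> euv ep sAB uA; have vA : v \in A.
  have /setUP[//|vB] : v \in A :|: B by apply: sAB; rewrite !inE eqxx orbT.
  by move: (noAB _ _ uA vB); rewrite euv.
move=> y /[1!inE]/predU1P[->//|]; apply: IHp => // z zp.
by apply: sAB; rewrite inE zp orbT.
Qed.

Lemma path_some_side (A B : {set T}) u p :
  (forall a b, a \in A -> b \in B -> ~~ e a b) ->
  path e u p -> {subset u :: p <= A :|: B} ->
  {subset u :: p <= A} \/ {subset u :: p <= B}.
Proof.
move=> noAB ep sAB; have /setUP[uA|uB] := sAB u (mem_head _ _).
  by left; apply: path_one_side ep sAB uA.
right; apply: (@path_one_side B A) ep _ uB => [a b aB bA|].
  by rewrite e_sym noAB.
by rewrite setUC.
Qed.

Lemma induced_forestU (A B : {set T}) :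
  (forall a b, a \in A -> b \in B -> ~~ e a b) ->
  induced_forest e A -> induced_forest e B -> induced_forest e (A :|: B).
Proof.
move=> noAB fA fB [x [p [p2 Up /allP sp ep el]]].
case: (path_some_side noAB ep sp) => sub; [apply: fA | apply: fB];
  by exists x, p; split=> //; apply/allP.
Qed.

(** Removing [x] from a cycle through it leaves a path, which cannot switch between [A] and [B]; the
    cycle then lies in [x |: A] or in [x |: B]. *)
Lemma induced_forestU1 (A B : {set T}) x :
  (forall a b, a \in A -> b \in B -> ~~ e a b) ->
  induced_forest e (x |: A) -> induced_forest e (x |: B) ->
  induced_forest e (x |: (A :|: B)).
Proof.
move=> noAB fA fB /has_cycle_inP[s cs].
have [xs|xs] := boolP (x \in s); last first.
  have : induced_forest e (A :|: B).
    by apply: induced_forestU => //; [apply: induced_forest_sub fA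
      | apply: induced_forest_sub fB]; apply: subsetUr.
  case: cs => s2 Us Fs es; apply; apply/has_cycle_inP; exists s; split=> // y ys.
  by move: (Fs y ys) (ys); rewrite !inE => /predU1P[->|//]; rewrite (negPf xs).
have [[|u p] [//= p1 /andP[xp Up] Fp /andP[exu ep] el]] := cycle_through cs xs.
have sp : {subset u :: p <= A :|: B}.
  move=> y yp; have := Fp y; rewrite inE yp orbT => /(_ isT)/setU1P[yx|//].
  by move: xp; rewrite -yx yp.
case: (path_some_side noAB ep sp) => sub; [apply: fA | apply: fB];
  exists x, (u :: p); (split=> //; [by rewrite /= xp | | by rewrite /= exu]);
  by apply/allP => y /[1!inE]/predU1P[->|/sub]; rewrite !inE ?eqxx // => ->; rewrite orbT.
Qed.

(** If [x] lies in both forests, it is kept and merely counted twice. Otherwise it is dropped, since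
    it might close a cycle with the other forest. Either way the count falls by at most one. *)
Lemma induced_forest_glue (F1 F2 : {set T}) x :
  (forall a b, a \in F1 :\ x -> b \in F2 :\ x -> ~~ e a b) ->
  (forall a, a \in F1 -> a \in F2 -> a = x) ->
  induced_forest e F1 -> induced_forest e F2 ->
  exists F : {set T}, [/\ F \subset F1 :|: F2, induced_forest e F
              & #|F1| + #|F2| <= #|F|.+1].
Proof.
move=> no12 F12 f1 f2.
have dis : [disjoint F1 :\ x & F2 :\ x].
  rewrite -setI_eq0; apply/eqP/setP => a; rewrite !inE.
  by apply/negP => /andP[/andP[/eqP ax a1] /andP[_ /(F12 _ a1)]].
have cU : #|F1 :\ x :|: F2 :\ x| = #|F1 :\ x| + #|F2 :\ x|.
  by apply/eqP; rewrite (leq_card_setU _ _).2.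
have s12 : F1 :\ x :|: F2 :\ x \subset F1 :|: F2 by rewrite setUSS ?subD1set.
rewrite (cardsD1 x F1) (cardsD1 x F2).
have [/andP[x1 x2]|x12] := boolP ((x \in F1) && (x \in F2)).
  exists (x |: (F1 :\ x :|: F2 :\ x)); split.
  - by rewrite subUset sub1set inE x1.
  - by apply: induced_forestU1; rewrite // setD1K.
  - by rewrite cardsU1 cU !inE eqxx x1 x2 /= addnACA.
exists (F1 :\ x :|: F2 :\ x); split=> //.
  by apply: induced_forestU => //; [apply: induced_forest_sub f1
    | apply: induced_forest_sub f2]; apply: subD1set.
by rewrite cU addnACA -addn1 addnC leq_add2l; case: (x \in F1) x12; case: (x \in F2).
Qed.

(** * Connected dominating sets and induced forests *)

Definition dominates (D S : {set T}) : Prop :=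
  {in S, forall s, s \in D \/ exists2 d, d \in D & e d s}.

Lemma dominates_adj (D S : {set T}) s :
  dominates D S -> s \in S -> exists2 d, d \in D & d = s \/ e d s.
Proof. by move=> dD /dD[|[d]]; [exists s; tauto | exists d; tauto]. Qed.

(* If a neighbor x of q is not a cut vertex, a dominating set of S :\ x through
   q also dominates x. Otherwise S splits at x into two parts, and both the
   dominating sets and the forests of the parts can be merged. *)
Lemma connected_dominating_forest (S : {set T}) q :
  connected_in S -> q \in S -> 1 < #|S| ->
  exists D F : {set T}, [/\ D \subset S, q \in D, connected_in D, dominates D S &
    [/\ F \subset S, induced_forest e F & #|D| < #|F|]].
Proof.
have [n] := ubnP #|S|; elim: n S q => // n IHn S q leSn cS qS S1.
have [b /setD1P[bq bS]] : exists b, b \in S :\ q.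
  by apply/set0Pn; rewrite -card_gt0; move: S1; rewrite (cardsD1 q S) qS.
have [x /setD1P[xq xS] qx] := connected_in_neighbor cS qS bS bq.
have cardS : #|S| = #|S :\ x|.+1 by rewrite (cardsD1 x S) xS.
have qSx : q \in S :\ x by rewrite !inE eq_sym xq.
have [Sx1|Sx1] := leqP #|S :\ x| 1.
  have Sx : S :\ x = [set q].
    by apply/esym/eqP; rewrite eqEcard sub1set qSx cards1.
  exists [set q], S; split; rewrite ?sub1set ?set11 //.
  - exact: connected_in1.
  - move=> s sS; have [->|sx] := eqVneq s x; first by right; exists q; rewrite ?set11.
    by left; rewrite -Sx !inE sx.
  - by rewrite cards1; split=> //; apply: induced_forest_small; rewrite cardS.
(* [K] is the component of [q] after [x] is removed, so edges of [S] leave [K] only towards [x]. *)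
pose K := [set u in S :\ x | connect (induced (S :\ x)) q u].
have qK : q \in K by rewrite inE qSx connect0.
have sKS : K \subset S by apply/subsetP => u; rewrite !inE => /andP[/andP[]].
have xK : x \notin K by rewrite !inE eqxx.
have outK u v : u \in K -> v \in S -> v \notin K -> e u v -> v = x.
  rewrite !inE => /andP[/andP[ux uS] qu] vS + euv.
  rewrite vS andbT negb_and negbK => /orP[/eqP//|] /negP nqv.
  have [//|vx] := eqVneq v x; case: nqv; apply: connect_trans qu _.
  by apply: connect1; rewrite /= euv !inE ux uS vx.
have [cut|ncut] := boolP [exists v, v \in (S :\ x) :\: K]; last first.
  have cSx : connected_in (S :\ x).
    apply: (@connected_in_root _ q) => u uSx.
    move: ncut; rewrite negb_exists => /forallP/(_ u).
    by rewrite in_setD uSx andbT negbK in_set => /andP[].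
  have [||D [F [sD qD cD dD [sF fF DF]]]] := IHn (S :\ x) q _ cSx qSx => //.
    by rewrite -ltnS -cardS.
  exists D, F; split=> //; first exact: subset_trans sD (subD1set _ _).
    move=> s sS; have [->|sx] := eqVneq s x; first by right; exists q.
    by apply: dD; rewrite !inE sx.
  by split=> //; apply: subset_trans sF (subD1set _ _).
have [v /setDP[/setD1P[vx vS] vK]] := existsP cut.
(* The two parts [x |: K] and [S :\: K] share only [x]. Collapsing the complement of either onto [x]
   shows that it is connected. *)
have xSK : x \in S :\: K by rewrite inE xK.
have sG1 : x |: K \subset S by rewrite subUset sub1set xS.
have sG2 : S :\: K \subset S by apply: subsetDl.
have cG1 : connected_in (x |: K).
  apply: (connected_in_retract (x := x) cS sG1); first exact: setU11.
  move=> a b' /setU1P[//|aK] b'S; rewrite in_setU1 negb_or => /andP[b'x b'K] eab.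
  by move: b'x; rewrite (outK a b') ?eqxx.
have cG2 : connected_in (S :\: K).
  apply: (connected_in_retract cS sG2 xSK) => a b' /setDP[aS aK] b'S.
  rewrite inE b'S andbT negbK => b'K; rewrite e_sym => eba.
  exact: outK eba.
have cardG : #|x |: K| < #|S| /\ #|S :\: K| < #|S|.
  split; apply: proper_card; rewrite properE ?sG1 ?sG2 /=; apply/subsetPn.
    by exists v => //; rewrite in_setU1 negb_or vx.
  by exists q => //; rewrite inE qK.
(* The first dominating set must contain [q]. The second is taken through [x], which [D1] dominates,
   so that their union is connected. *)
have [||||D1 [F1 [sD1 qD1 cD1 dD1 [sF1 fF1 DF1]]]] := IHn (x |: K) q.
- by apply: leq_trans cardG.1 _; rewrite -ltnS.
- exact: cG1.
- by rewrite inE qK orbT.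
- by rewrite cardsU1 xK ltnS card_gt0; apply/set0Pn; exists q.
have [||||D2 [F2 [sD2 xD2 cD2 dD2 [sF2 fF2 DF2]]]] := IHn (S :\: K) x.
- by apply: leq_trans cardG.2 _; rewrite -ltnS.
- exact: cG2.
- exact: xSK.
- rewrite (cardsD1 x) xSK ltnS card_gt0; apply/set0Pn; exists v.
  by rewrite in_setD1 vx inE vK.
have [d dD1' dx] := dominates_adj dD1 (setU11 x K).
have inK a : a \in F1 :\ x -> a \in K.
  by case/setD1P=> ax /(subsetP sF1)/setU1P[/eqP|//]; rewrite (negPf ax).
have [|a a1 a2|F [sF fF cF]] := induced_forest_glue (x := x) _ _ fF1 fF2.
- move=> a c /inK aK /setD1P[cx /(subsetP sF2)/setDP[cS' cK]].
  by apply: contraNN cx => eac; rewrite (outK a c).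
- have [//|ax] := eqVneq a x; have aK : a \in K by apply: inK; rewrite !inE ax.
  by have /setDP[_ /negP] := subsetP sF2 _ a2.
exists (D1 :|: D2), F; split.
- by rewrite subUset (subset_trans sD1) // (subset_trans sD2).
- by rewrite inE qD1.
- exact: connected_inU cD1 cD2 dD1' xD2 dx.
- move=> s sS; have [sK|sK] := boolP (s \in K).
    have [|s1|[c cD cs]] := dD1 s; first by rewrite inE sK orbT.
      by left; rewrite inE s1.
    by right; exists c; rewrite // inE cD.
  have [|s1|[c cD cs]] := dD2 s; first by rewrite inE sK.
    by left; rewrite inE s1 orbT.
  by right; exists c; rewrite // inE cD orbT.
split=> //.
  apply: subset_trans sF _.
  by rewrite subUset (subset_trans sF1) // (subset_trans sF2).
(* Each forest exceeds its dominating set by at least one, and gluing costs at most one, so the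
   strict inequality survives. *)
rewrite -ltnS; apply: leq_trans cF.
apply: leq_trans (leq_add DF1 DF2); rewrite addSn addnS !ltnS.
exact: leq_card_setU.
Qed.

(** * Walks and their color sequences *)

(** Vertices may repeat, which makes concatenation unconditional. Colors are natural numbers, so
    fresh ones can be added without changing the type of the coloring. *)
Inductive colored_walk (r : rel T) (col : {set T} -> nat) : T -> T -> seq nat -> Prop :=
| CWnil u : colored_walk r col u u [::]
| CWcons u v w s : r u v -> colored_walk r col v w s ->
    colored_walk r col u w (col [set u; v] :: s).

Lemma colored_walk1 (r : rel T) col u v c :
  r u v -> col [set u; v] = c -> colored_walk r col u v [:: c].
Proof. by move=> ruv <-; apply: CWcons ruv (CWnil _ _ _). Qed.

Lemma colored_walk_cat r col u v w s t :
  colored_walk r col u v s -> colored_walk r col v w t ->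
  colored_walk r col u w (s ++ t).
Proof. by elim=> //= {}u {}v z {}s ruv _ IH /IH; apply: CWcons. Qed.

Lemma colored_walk_rev (r : rel T) col u v s : symmetric r ->
  colored_walk r col u v s -> colored_walk r col v u (rev s).
Proof.
move=> rsym; elim=> [{}u|{}u {}v w {}s ruv _ IH]; first exact: CWnil.
rewrite rev_cons -cats1; apply: colored_walk_cat IH _.
by apply: colored_walk1; [rewrite rsym | rewrite setUC].
Qed.

Lemma colored_walk_sub (r r' : rel T) col col' u v s :
  (forall a b, r a b -> r' a b /\ col [set a; b] = col' [set a; b]) ->
  colored_walk r col u v s -> colored_walk r' col' u v s.
Proof.
move=> sub; elim=> [{}u|{}u {}v w {}s /sub[ruv ->] _ IH]; first exact: CWnil.
exact: CWcons.
Qed.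

(* Cutting a loop out of a walk only deletes colors. *)
Lemma colored_walk_path (r : rel T) col u v s : colored_walk r col u v s ->
  exists p, [/\ path r u p, last u p = v, uniq (u :: p)
    & subseq (pairmap (fun a b => col [set a; b]) u p) s].
Proof.
elim=> [{}u|{}u {}v w {}s ruv _ [p [rp lp Up sp]]]; first by exists [::].
have [up|up] := boolP (u \in v :: p); last first.
  by exists (v :: p); rewrite /= ruv rp up eqxx; split.
have suff_p : exists2 p', path r u p' /\ last u p' = w & uniq (u :: p') /\
    subseq (pairmap (fun a b => col [set a; b]) u p')
           (pairmap (fun a b => col [set a; b]) v p).
  move: up; rewrite inE => /predU1P[->|up]; first by exists p.
  move: up rp lp Up {sp}; case/splitPr=> p1 p2.
  rewrite cat_path last_cat /= => /and3P[_ _ rp2] lp2.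
  rewrite cat_uniq => /and4P[_ _ _ Up2]; exists p2; split=> //.
  rewrite pairmap_cat /=; apply: subseq_trans (suffix_subseq _ _).
  exact: subseq_cons.
have [p' [rp' lp'] [Up' sp']] := suff_p.
exists p'; split=> //; apply: subseq_trans sp' _.
exact: subseq_trans sp (subseq_cons _ _).
Qed.

(** * Rainbow colorings of a vertex set *)

(** Walks with distinct colors are enough: by [colored_walk_path] they shorten to paths whose colors
    are still distinct. *)
Definition rainbow_in (S : {set T}) (k : nat) : Prop :=
  exists col, {in S &, forall u v, exists s,
    [/\ colored_walk (induced S) col u v s, uniq s & all (gtn k) s]}.

Lemma rainbow_in1 x k : rainbow_in [set x] k.
Proof.
by exists (fun=> 0) => u v /set1P-> /set1P->; exists [::]; split=> //; apply: CWnil.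
Qed.

Lemma rainbow_in_leq S k k' : k <= k' -> rainbow_in S k -> rainbow_in S k'.
Proof.
move=> kk' [col cP]; exists col => u v uS vS.
have [s [ws Us /allP ks]] := cP u v uS vS; exists s; split=> //.
by apply/allP => c /ks ck; apply: leq_trans kk'.
Qed.

(** The edge from [z] to [w] takes the fresh color [k], which prolongs any rainbow walk ending at
    [z]. This serves both to grow a spanning tree and to restore a deleted vertex of degree 1. *)
Lemma rainbow_in_extend (X : {set T}) k z w :
  rainbow_in X k -> z \in X -> w \notin X -> e z w -> rainbow_in (w |: X) k.+1.
Proof.
(* Every pair containing [w] is recolored; walks inside [X] avoid [w] and keep their colors. *)
move=> [col cP] zX wX ezw.
pose col' (E : {set T}) := if w \in E then k else col E.
have sub u v s : colored_walk (induced X) col u v s ->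
    colored_walk (induced (w |: X)) col' u v s.
  apply: colored_walk_sub => a b /and3P[eab aX bX].
  rewrite /= eab !inE aX bX !orbT; split=> //.
  rewrite /col' !inE; case: ifP => // /orP[] /eqP wE; move: wX; rewrite wE.
    by rewrite aX.
  by rewrite bX.
have wk u : u \in X -> exists s,
    [/\ colored_walk (induced (w |: X)) col' u w s, uniq s & all (gtn k.+1) s].
  move=> uX; have [s [ws Us ks]] := cP u z uX zX; exists (rcons s k); split.
  - rewrite -cats1; apply: colored_walk_cat (sub _ _ _ ws) _.
    apply: colored_walk1; first by rewrite /= ezw !inE zX eqxx orbT.
    by rewrite /col' !inE eqxx orbT.
  - rewrite rcons_uniq Us andbT; apply/negP => /(allP ks) /=.
    by rewrite ltnn.
  - rewrite all_rcons /= ltnSn; apply: sub_all ks => c; exact: leqW.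
exists col' => u v /setU1P[->|uX] /setU1P[->|vX].
- by exists [::]; split=> //; apply: CWnil.
- have [s [ws Us ks]] := wk v vX; exists (rev s).
  rewrite rev_uniq all_rev; split=> //; apply: colored_walk_rev ws.
  exact: induced_sym.
- exact: wk.
- have [s [ws Us ks]] := cP u v uX vX; exists s; split=> //; first exact: sub.
  apply: sub_all ks => c; exact: leqW.
Qed.

(** A spanning tree is grown from [r] along crossing edges, each new vertex bringing one color. The
    starting vertex is also granted one, so the count is that of vertices, not of tree edges. *)
Lemma rainbow_in_card (D : {set T}) r :
  connected_in D -> r \in D -> rainbow_in D #|D|.
Proof.
move=> cD rD.
suff [X [rX sX cX XR]] : exists X : {set T},
    [/\ r \in X, X \subset D, #|X| = #|D| & rainbow_in X #|X|].
  suff <- : X = D by [].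
  by apply/eqP; rewrite eqEcard sX cX leqnn.
have D0 : 0 < #|D| by rewrite card_gt0; apply/set0Pn; exists r.
suff H n : n < #|D| -> exists X : {set T},
    [/\ r \in X, X \subset D, #|X| = n.+1 & rainbow_in X #|X|].
  by have := H #|D|.-1; rewrite prednK // leqnn; apply.
elim: n => [_|n IHn nD].
  by exists [set r]; rewrite set11 sub1set cards1; split=> //; apply: rainbow_in1.
have [X [rX sX cX XR]] := IHn (ltnW nD).
have /subsetPn[b bD bX] : ~~ (D \subset X).
  by apply: contraL nD => /subset_leq_card; rewrite cX -leqNgt.
have [u [v [uX vD vX euv]]] := connected_in_crossing cD rX sX bD bX.
exists (v |: X); split; first by rewrite inE rX orbT.
- by rewrite subUset sub1set vD.
- by rewrite cardsU1 vX cX.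
- by rewrite cardsU1 vX; apply: rainbow_in_extend XR uX vX euv.
Qed.

Definition independent (X : {set T}) : bool :=
  [forall u in X, forall v in X, ~~ e u v].

(* With a, b, c three fresh colors and X a maximal independent subset of
   H := S :\: D, color a the edges from X to D, b the edges from H :\: X to D
   and c the edges inside H, except that a vertex of X with two neighbors in D
   gets b on one of the two edges. Then every vertex of X reaches D by a and by
   a subset of {b, c}, every vertex of H :\: X by b and by {c, a}. *)
Lemma rainbow_in_dominated (S D : {set T}) k :
  D \subset S -> rainbow_in D k -> dominates D S ->
  {in S, forall x, exists u v, [/\ u \in S, v \in S, u != v, e x u & e x v]} ->
  rainbow_in S k.+3.
Proof.
move=> sDS [tcol tP] dD deg2.
pose H := S :\: D.
have ind0 : independent set0 && (set0 \subset H).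
  by rewrite sub0set andbT; apply/forallP => u; rewrite inE.
have [X /maxsetP[/andP[indX sXH] maxX] _] :=
  @maxset_exists _ (fun X => independent X && (X \subset H)) set0 ind0.
have noX u v : u \in X -> v \in X -> e u v = false.
  by move=> uX vX; apply/negbTE; move/forall_inP: indX => /(_ u uX)/forall_inP; apply.
have adjX y : y \in H -> y \notin X -> exists2 x, x \in X & e y x.
  move=> yH yX; have [/exists_inP[x]|/exists_inPn no] := boolP [exists x in X, e y x].
    by exists x.
  case/negP: yX; rewrite -(maxX (y |: X)) ?setU11 ?subsetUr //.
  rewrite subUset sub1set yH sXH !andbT.
  apply/forall_inP => u /setU1P[->|uX]; apply/forall_inP => v /setU1P[->|vX].
  - by rewrite eirr.
  - exact: no.
  - by rewrite e_sym no.
  - by rewrite noX.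
(* [g x] selects the edge from [x] to [D] that gets [b] instead of [a]. The default [x] is harmless:
   for [x] outside [D] it differs from every vertex of [D]. *)
pose g x := odflt x [pick d in D | e x d && [exists d' in D, (d' != d) && e x d']].
pose a := k; pose b := k.+1; pose c := k.+2.
(* A color depends on an unordered pair, so the endpoint outside [D] must be recovered by
   existential tests; [colHH] and [colHD] restate the result with endpoints named. *)
pose col (E : {set T}) :=
  if E \subset D then tcol E else if [disjoint E & D] then c else
  if [exists y in E, (y \in H) && (y \notin X)] || [exists x in X, E == [set x; g x]]
  then b else a.
have HD h : h \in H -> h \notin D by case/setDP.
have HS h : h \in H -> h \in S by case/setDP.
have DS d : d \in D -> d \in S := subsetP sDS d.
have XH x : x \in X -> x \in H := subsetP sXH x.
have colHH u v : u \in H -> v \in H -> col [set u; v] = c.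
  move=> /HD uD /HD vD; rewrite /col subUset sub1set (negPf uD) /=.
  by rewrite disjoints_subset subUset !sub1set !inE uD vD.
have colHD h d : h \in H -> d \in D -> col [set h; d] =
    if (h \notin X) || (d == g h) then b else a.
  move=> hH dD'; rewrite /col subUset sub1set (negPf (HD h hH)) /=.
  rewrite ifN; last first.
    by rewrite -setI_eq0; apply/set0Pn; exists d; rewrite !inE eqxx dD' orbT.
  congr (if _ then _ else _); apply/idP/idP.
    case/orP=> [/exists_inP[y]|/exists_inP[x xX /eqP/setP E]].
      rewrite !inE => /orP[]/eqP-> => [/andP[_ ->]//|].
      by rewrite dD'.
    have := E h; rewrite !inE eqxx /= => /esym hx.
    have := E d; rewrite !inE eqxx orbT => /esym dx.
    have xE := E x; rewrite !inE eqxx /= in xE.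
    have xd : x == d = false.
      by apply/negP => /eqP xd; move: (HD x (XH x xX)); rewrite xd dD'.
    move: xE; rewrite xd orbF => /eqP xh; subst x.
    by move: dx; rewrite eq_sym xd /= => ->; rewrite orbT.
  case/orP=> [hX|/eqP dg].
    by apply/orP; left; apply/exists_inP; exists h; rewrite ?inE ?eqxx // -in_setD hH.
  have [hX|hX] := boolP (h \in X); last first.
    by apply/orP; left; apply/exists_inP; exists h; rewrite ?inE ?eqxx // -in_setD hH.
  by apply/orP; right; apply/exists_inP; exists h; rewrite // -dg.
pose walk := colored_walk (induced S) col.
have walkD u v : u \in D -> v \in D ->
    exists s, [/\ walk u v s, uniq s & all (gtn k) s].
  move=> uD vD; have [s [ws Us ks]] := tP u v uD vD; exists s; split=> //.
  apply: colored_walk_sub ws => x y /and3P[exy xD yD].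
  rewrite /= exy !DS //; split=> //.
  by rewrite /col subUset !sub1set xD yD.
have adjD h : h \in H -> exists2 d, d \in D & e h d.
  move=> hH; have [hD|[d dD' edh]] := dD h (HS h hH).
    by move: (HD h hH); rewrite hD.
  by exists d; rewrite // e_sym.
have edge u v : e u v -> u \in S -> v \in S -> induced S u v.
  by move=> /= -> -> ->.
have Yb y : y \in H -> y \notin X -> exists2 d, d \in D & walk y d [:: b].
  move=> yH yX; have [d dD' eyd] := adjD y yH; exists d => //.
  by apply: colored_walk1; [apply: edge; auto | rewrite colHD // yX].
have Xa x : x \in X -> exists2 d, d \in D & walk x d [:: a].
  move=> xX; have xH := XH x xX; have [d dD' exd] := adjD x xH.
  suff [d' dD'' /andP[exd' /negPf d'g]] : exists2 d', d' \in D & e x d' && (d' != g x).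
    exists d' => //.
    by apply: colored_walk1; [apply: edge; auto | rewrite colHD // xX d'g].
  (* If [g x] is a genuine neighbor in [D], its choice supplies a second one; otherwise any neighbor
     in [D] differs from the default. *)
  rewrite /g; case: pickP => [d1 /and3P[d1D exd1 /exists_inP[d2 d2D /andP[d21 exd2]]]|_] /=.
    by exists d2; rewrite ?exd2.
  exists d => //; rewrite exd /=; apply: contraNneq (HD x xH) => <- //.
have Xb x : x \in X -> exists2 d, d \in D & walk x d [:: b] \/ walk x d [:: c; b].
  move=> xX; have xH := XH x xX.
  (* A neighbor [y] in [H] is outside [X] by independence and gives the exit [c], [b]. Without one,
     both neighbors from the degree condition lie in [D], so [g x] is genuine and its edge has color
     [b]. *)
  have [/exists_inP[y yH exy]|/exists_inPn no] := boolP [exists y in H, e x y].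
    have yX : y \notin X by apply: contraTN exy => yX; rewrite noX.
    have [d dD' wd] := Yb y yH yX; exists d => //; right.
    rewrite -(colHH x y) //; apply: CWcons wd; apply: edge; auto.
  have [u [v [uS vS uv exu exv]]] := deg2 x (HS x xH).
  have inD z : z \in S -> e x z -> z \in D.
    by move=> zS; apply: contraTT => zD; apply: no; rewrite inE zD.
  have : g x \in D /\ e x (g x).
    rewrite /g; case: pickP => [d1 /and3P[]//|/(_ u)] /=.
    rewrite inD // exu /= => /negbT/exists_inPn/(_ v (inD v vS exv)).
    by rewrite exv eq_sym uv.
  case=> gD exg; exists (g x) => //; left.
  by apply: colored_walk1; [apply: edge; auto | rewrite colHD // eqxx orbT].
have Ya y : y \in H -> y \notin X -> exists2 d, d \in D & walk y d [:: c; a].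
  move=> yH yX; have [x xX eyx] := adjX y yH yX; have [d dD' wd] := Xa x xX.
  exists d => //; rewrite -(colHH y x) //; last exact: XH.
  by apply: CWcons wd; apply: edge; auto.
(* Two exits with disjoint fresh colors are linked by a rainbow walk inside [D], whose colors are
   all below [k]. *)
have join u v d1 d2 s1 s2 : d1 \in D -> d2 \in D -> walk u d1 s1 -> walk v d2 s2 ->
    uniq (s1 ++ s2) -> {subset s1 ++ s2 <= [:: a; b; c]} ->
    exists s, [/\ walk u v s, uniq s & all (gtn k.+3) s].
  move=> d1D d2D w1 w2 U12 abc; have [s [ws Us ks]] := walkD d1 d2 d1D d2D.
  have new x : x \in s1 ++ s2 -> k <= x < k.+3.
    move/abc; rewrite !inE => /or3P[]/eqP->; rewrite ltnS.
    - by rewrite leqnn ltnW.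
    - by rewrite !leqnSn.
    - by rewrite leqnn andbT ltnW.
  have old x : x \in s -> x < k := allP ks x.
  exists (s1 ++ s ++ rev s2); split.
  - apply: colored_walk_cat w1 _; apply: colored_walk_cat ws _.
    by apply: colored_walk_rev w2; apply: induced_sym.
  - rewrite uniq_catCA cat_uniq Us /= (@perm_uniq _ _ (s1 ++ s2)) ?perm_cat2l ?perm_rev //.
    rewrite U12 andbT; apply/hasPn => x; rewrite mem_cat mem_rev -mem_cat => /new/andP[kx _].
    by apply/negP => /old; rewrite ltnNge kx.
  - apply/allP => x; rewrite !mem_cat mem_rev orbCA => /orP[/old xk|]; last first.
      by rewrite -mem_cat => /new/andP[].
    by apply: leq_trans xk _; rewrite -addn3 leq_addr.
have [ab ac bc] : [/\ a != b, a != c & b != c].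
  by rewrite /a /b /c; split; rewrite ltn_eqF.
have exitH h : h \in H -> exists d s, [/\ d \in D, walk h d s, uniq s
    & {subset s <= [:: a; b; c]}].
  move=> hH; have [hX|hX] := boolP (h \in X).
    have [d dD' wd] := Xa h hX; exists d, [:: a]; split=> // x.
    by rewrite !inE => ->.
  have [d dD' wd] := Yb h hH hX; exists d, [:: b]; split=> // x.
  by rewrite !inE => ->; rewrite orbT.
have sym u v : (exists s, [/\ walk u v s, uniq s & all (gtn k.+3) s]) ->
    exists s, [/\ walk v u s, uniq s & all (gtn k.+3) s].
  case=> s [ws Us ks]; exists (rev s); rewrite rev_uniq all_rev; split=> //.
  by apply: colored_walk_rev ws; apply: induced_sym.
have abcP s : all (mem [:: a; b; c]) s -> {subset s <= [:: a; b; c]} by move/allP.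
(* The exit colors are [a] against [b] or [c], [b] for two vertices of [X], [a] against [b] for a
   mixed pair, and [c], [a] against [b] for two vertices of [H :\: X]. *)
have XX u v : u \in X -> v \in X -> exists s, [/\ walk u v s, uniq s & all (gtn k.+3) s].
  move=> uX vX; have [d1 d1D w1] := Xa u uX; have [d2 d2D [w2|w2]] := Xb v vX.
    apply: join w1 w2 _ _ => //=; first by rewrite inE ab.
    by apply: abcP; rewrite /= !inE !eqxx !orbT.
  apply: join w1 w2 _ _ => //=; first by rewrite !inE negb_or ab ac eq_sym bc.
  by apply: abcP; rewrite /= !inE !eqxx !orbT.
have XY u v : u \in X -> v \in H -> v \notin X ->
    exists s, [/\ walk u v s, uniq s & all (gtn k.+3) s].
  move=> uX vH vX; have [d1 d1D w1] := Xa u uX; have [d2 d2D w2] := Yb v vH vX.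
  apply: join w1 w2 _ _ => //=; first by rewrite inE ab.
  by apply: abcP; rewrite /= !inE !eqxx !orbT.
have YY u v : u \in H -> u \notin X -> v \in H -> v \notin X ->
    exists s, [/\ walk u v s, uniq s & all (gtn k.+3) s].
  move=> uH uX vH vX; have [d1 d1D w1] := Ya u uH uX.
  have [d2 d2D w2] := Yb v vH vX.
  apply: join w1 w2 _ _ => //=.
    by rewrite !inE negb_or ab ![c == _]eq_sym ac bc.
  by apply: abcP; rewrite /= !inE !eqxx !orbT.
have DH u v : u \in D -> v \in H -> exists s, [/\ walk u v s, uniq s & all (gtn k.+3) s].
  move=> uD vH; have [d [s [dD' wd Us abc]]] := exitH v vH.
  exact: (join u v u d [::] s uD dD' (CWnil _ _ _) wd Us abc).
have DD u v : u \in D -> v \in D -> exists s, [/\ walk u v s, uniq s & all (gtn k.+3) s].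
  move=> uD vD.
  exact: (join u v u v [::] [::] uD vD (CWnil _ _ _) (CWnil _ _ _)).
exists col => u v uS vS.
have inH x : x \in S -> x \notin D -> x \in H by move=> xS xD; rewrite inE xD.
have [uD|/(inH _ uS) uH] := boolP (u \in D);
  have [vD|/(inH _ vS) vH] := boolP (v \in D); auto.
by have [uX|uX] := boolP (u \in X); have [vX|vX] := boolP (v \in X); auto.
Qed.

(** The forest is built together with the coloring: each deleted vertex of degree 1 pays for its
    color by joining [F]. *)
Lemma rainbow_in_forest (S : {set T}) q :
  connected_in S -> q \in S ->
  exists F : {set T}, [/\ F \subset S, induced_forest e F & rainbow_in S (#|F| + 2)].
Proof.
have [n] := ubnP #|S|; elim: n S q => // n IHn S q leSn cS qS.
have [S1|S1] := leqP #|S| 1.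
  have -> : S = [set q] by apply/esym/eqP; rewrite eqEcard sub1set qS cards1.
  exists [set q]; split=> //; last exact: rainbow_in1.
  by apply: induced_forest_small; rewrite cards1.
pose deg2 x := [exists u in S, exists v in S, [&& u != v, e x u & e x v]].
have [/forall_inP all2|/forall_inPn[l lS ldeg]] := boolP [forall x in S, deg2 x].
  have [D [F [sD qD cD dD [sF fF DF]]]] := connected_dominating_forest cS qS S1.
  (* Since [D] is smaller than [F], the [#|D|] tree colors and three more number at most
     [#|F| + 2]. *)
  exists F; split=> //; apply: (@rainbow_in_leq _ #|D|.+3).
    by rewrite addn2 !ltnS.
  apply: rainbow_in_dominated sD _ dD _; first exact: rainbow_in_card qD.
  move=> x /all2/exists_inP[u uS /exists_inP[v vS /and3P[*]]].
  by exists u, v.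
have l1 u v : u \in S -> v \in S -> e l u -> e l v -> u = v.
  move=> uS vS elu elv; apply/eqP; apply: contraNT ldeg => uv.
  apply/exists_inP; exists u => //; apply/exists_inP; exists v => //.
  by rewrite uv elu.
have [b /setD1P[bl bS]] : exists b, b \in S :\ l.
  by apply/set0Pn; rewrite -card_gt0; move: S1; rewrite (cardsD1 l S) lS.
have [z zSl elz] := connected_in_neighbor cS lS bS bl.
have /setD1P[zl zS] := zSl.
have cSl : connected_in (S :\ l).
  (* The vertex [l] collapses onto its only neighbor [z]. *)
  apply: (connected_in_retract cS (subD1set _ _) zSl) => u v /setD1P[ul uS] vS.
  rewrite !inE vS andbT negbK => /eqP->; rewrite e_sym => elu.
  exact: l1.
have [|F [sF fF RF]] := IHn (S :\ l) z _ cSl zSl.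
  by move: leSn; rewrite (cardsD1 l S) lS ltnS.
have sFS : F \subset S := subset_trans sF (subD1set _ _).
have lF : l \notin F by apply/negP => /(subsetP sF); rewrite !inE eqxx.
exists (l |: F); split.
- by rewrite subUset sub1set lS.
- exact: induced_forest_pendant l1 fF.
- rewrite cardsU1 lF -[S](setD1K lS) addSn.
  by apply: rainbow_in_extend RF zSl _ _; rewrite ?inE ?eqxx // e_sym.
Qed.

End Graph.

(** * Passage to a finite palette on the whole graph *)

Theorem theorem1 (T : finType) (e : rel T) (m : nat) :
  simple_graph e -> connected_graph e -> forest_number e m ->
  rc_at_most e (m + 2).
Proof.
move=> [e_sym eirr] cG [_ maxF]; exists (m + 2) => //.
have m2 : 0 < m + 2 by rewrite addn2.
(* On the empty graph any coloring works; otherwise some vertex [q] starts the construction. *)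
have [/existsP[q _]|/existsPn T0] := boolP [exists x : T, true]; last first.
  by exists [ffun=> Ordinal m2] => x; have := T0 x.
have cT : connected_in e [set: T].
  move=> u v _ _; apply: connect_sub (cG u v) => a b eab.
  by apply: connect1; rewrite /induced eab !inE.
have [F [_ fF RF]] := rainbow_in_forest e_sym eirr cT (in_setT q).
have [col cP] : rainbow_in e [set: T] (m + 2).
  by apply: rainbow_in_leq RF; rewrite leq_add2r maxF.
(* Out-of-range colors are sent to 0. This cannot create a repetition on [p], whose colors come from
   [s] and are below [m + 2]. *)
exists [ffun E => insubd (Ordinal m2) (col E)] => u v.
have [s [ws Us ks]] := cP u v (in_setT u) (in_setT v).
have [p [ep lp Up sp]] := colored_walk_path ws.
exists p; apply/and4P; split=> //; last 1 first.
- rewrite -(map_inj_uniq val_inj).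
  suff -> : map val (path_colors [ffun E => insubd (Ordinal m2) (col E)] u p)
          = pairmap (fun a b => col [set a; b]) u p by apply: subseq_uniq Us.
  have {sp} : all (gtn (m + 2)) (pairmap (fun a b => col [set a; b]) u p).
    by apply/allP => c /(mem_subseq sp)/(allP ks).
  elim: p u {ep lp Up ws} => //= w p IHp u /andP[cuw /IHp <-].
  by rewrite ffunE val_insubd cuw.
- by apply: sub_path ep => a b /and3P[].
- exact/eqP.
Qed.
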